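(* Let $\mathbf{f}$ be the Fibonacci word and let $\mathbf{cubes_f}$ be the infinite binary word whose $n$-th term ($n\ge 0$) is $1$ if a cube ends at position $n$ of $\mathbf{f}$ and $0$ otherwise. Then: \begin{itemize} \item the runs of $0$'s in $\mathbf{cubes_f}$ of length $8$ begin exactly at the positions $i$ with $(i)_F\in(10)^+0001$; \item the runs of $0$'s in $\mathbf{cubes_f}$ of length $7$ begin exactly at the positions $i$ with $(i)_F\in(10)^+01001$. \end{itemize}
   Context: The Fibonacci word is $\mathbf{f}=010010100100101001010010\cdots$, the fixed point of the morphism $0\mapsto 01$, $1\mapsto 0$; its letters are indexed starting from position $0$, and $\mathbf{f}[a..b]$ denotes the factor occupying positions $a$ through $b$. A cube is a word of the form $xxx$ with $x$ nonempty. A cube ends at position $j$ of $\mathbf{f}$ if there exist $i\ge 0$ and $m\ge 1$ with $j=i+3m-1$ such that $\mathbf{f}[i..j]=xxx$ for some word $x$ of length $m$. A run of $0$'s of length $\ell\ge1$ beginning at position $i$ in a binary word $\mathbf{u}=u_0u_1\cdots$ means $u_i=\cdots=u_{i+\ell-1}=0$, $u_{i+\ell}=1$, and either $i=0$ or $u_{i-1}=1$. Fibonacci numbers: $F_0=0$, $F_1=1$, $F_{k+2}=F_{k+1}+F_k$. For $n\ge0$, $(n)_F$ is the canonical Fibonacci (Zeckendorf) representation of $n$: the unique binary word $d_k\cdots d_2$ (most significant digit first), with no leading $0$ and no two consecutive $1$'s, such that $n=\sum_j d_jF_j$ (the last digit has weight $F_2=1$). In the regular expressions, $(10)^+$ denotes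 one or more repetitions of $10$. *)

(* Defs.v *)
(* MathComp world.  Binary letters are booleans (false is 0, true is 1), finite
   words are [seq bool], infinite words are functions [nat -> bool]. *)
From mathcomp Require Import all_boot.
From mathcomp Require Import boolp.
From mathcomp Require Import zify.

Set Implicit Arguments.
Unset Strict Implicit.
Unset Printing Implicit Defensive.

Notation word := (seq bool).
Notation infword := (nat -> bool).

Definition fib_image (a : bool) : word :=
  if a then [:: false] else [:: false; true].

Definition fib_morphism (w : word) : word := flatten (map fib_image w).

Definition fibonacci_iter (k : nat) : word := iter k fib_morphism [:: false].

(* The [k]-th iterate is longer than [k] and is a prefix of all later ones, so
   the default letter is never reached.  [fixed_fibonacci_word] and
   [fixed_fib_morphism_unique] show that this is the unique fixed point. *)
Definition fibonacci_word : infword :=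
  fun n => nth false (fibonacci_iter n) n.

(* [u] is fixed by the morphism iff the image of each prefix of [u] is again a
   prefix of [u]. *)
Definition fixed_by_fib_morphism (u : infword) : Prop :=
  forall n, fib_morphism (mkseq u n) = mkseq u (size (fib_morphism (mkseq u n))).

Lemma fib_morphism_cat v w :
  fib_morphism (v ++ w) = fib_morphism v ++ fib_morphism w.
Proof. by rewrite /fib_morphism map_cat flatten_cat. Qed.

Lemma prefix_fib_morphism v w :
  prefix v w -> prefix (fib_morphism v) (fib_morphism w).
Proof. by case/prefixP=> t ->; rewrite fib_morphism_cat prefix_prefix. Qed.

Lemma prefix_fibonacci_iter j k :
  j <= k -> prefix (fibonacci_iter j) (fibonacci_iter k).
Proof.
move=> /subnKC <-; elim: (k - j) => [|d IH]; first by rewrite addn0 prefix_refl.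
apply: prefix_trans IH _; rewrite addnS.
elim: (j + d) => //= n IH; exact: prefix_fib_morphism.
Qed.

Lemma size_fib_morphism w : size w <= size (fib_morphism w) <= (size w).*2.
Proof.
elim: w => //= a w; rewrite /fib_morphism /= size_cat -/(fib_morphism w).
by case: a => /=; lia.
Qed.

Lemma size_fibonacci_iter k : k < size (fibonacci_iter k).
Proof.
elim: k => //= k IH; have := prefix_fibonacci_iter (leq0n k).
case/prefixP=> t E; rewrite E in IH *; rewrite fib_morphism_cat size_cat.
have /andP[le_t _] := size_fib_morphism t.
move: IH; rewrite size_cat /=; lia.
Qed.

Lemma fibonacci_wordE k n :
  n < size (fibonacci_iter k) -> fibonacci_word n = nth false (fibonacci_iter k) n.
Proof.
move=> lt_n; rewrite /fibonacci_word.
have lt_nn := size_fibonacci_iter n.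
case/orP: (leq_total n k) => /prefix_fibonacci_iter/prefixP[t E].
  by rewrite E nth_cat lt_nn.
by rewrite E nth_cat lt_n.
Qed.

Lemma mkseq_fibonacci_word w k :
  prefix w (fibonacci_iter k) -> mkseq fibonacci_word (size w) = w.
Proof.
case/prefixP=> t E; apply: (@eq_from_nth _ false); first by rewrite size_mkseq.
move=> i; rewrite size_mkseq => lt_i; rewrite nth_mkseq //.
by rewrite (@fibonacci_wordE k) E ?nth_cat ?lt_i // size_cat ltn_addr.
Qed.

Lemma fixed_fibonacci_word : fixed_by_fib_morphism fibonacci_word.
Proof.
move=> n; symmetry; apply: (@mkseq_fibonacci_word _ n.+1).
apply: prefix_fib_morphism; apply/prefixP; exists (drop n (fibonacci_iter n)).
rewrite -[LHS](cat_take_drop n); congr (_ ++ _).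
have szt : size (take n (fibonacci_iter n)) = n.
  by rewrite size_takel // ltnW ?size_fibonacci_iter.
rewrite -[in RHS]szt; symmetry; apply: (@mkseq_fibonacci_word _ n); exact: prefix_take.
Qed.

Lemma fixed_fib_morphism_unique u :
  fixed_by_fib_morphism u -> u =1 fibonacci_word.
Proof.
move=> fix_u.
have u0 : u 0 = false.
  by case E: (u 0) => //; have := fix_u 1; rewrite /mkseq /= E /= E.
have iterE k : fibonacci_iter k = mkseq u (size (fibonacci_iter k)).
  elim: k => [|k IH]; first by rewrite /mkseq /= u0.
  rewrite (_ : fibonacci_iter k.+1 = fib_morphism (fibonacci_iter k)) // IH.
  exact: fix_u.
move=> n; rewrite /fibonacci_word iterE nth_mkseq //; exact: size_fibonacci_iter.
Qed.

(* The factor occupying positions [a] through [b], inclusive. *)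
Definition factor (u : infword) (a b : nat) : word :=
  [seq u k | k <- iota a (b.+1 - a)].

Definition cube_ends_at (u : infword) (j : nat) : Prop :=
  exists (i m : nat) (x : word),
    [/\ 0 < m, j = i + 3 * m - 1, size x = m & factor u i j = x ++ x ++ x].

Definition cubes_f : infword := fun n => `[< cube_ends_at fibonacci_word n >].

Definition zero_run (u : infword) (len i : nat) : Prop :=
  [/\ 0 < len,
      forall t, t < len -> u (i + t) = false,
      u (i + len) = true
    & i = 0 \/ u (i - 1) = true].

Fixpoint fib (n : nat) : nat :=
  match n with
  | 0 => 0
  | n'.+1 => if n' is n''.+1 then fib n' + fib n'' else 1
  end.

(* Words are written most significant digit first; the last digit has weight
   [fib 2]. *)
Definition fib_value (w : word) : nat :=
  \sum_(j < size w) nth false (rev w) j * fib (j + 2).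

(* [head true w] says that there is no leading 0; the representation of 0 is
   the empty word. *)
Definition canonical_fib_rep (n : nat) (w : word) : bool :=
  [&& head true w, ~~ infix [:: true; true] w & fib_value w == n].

Lemma fibSS n : fib n.+2 = fib n.+1 + fib n.
Proof. by []. Qed.

Lemma fib_value_cons b w : fib_value (b :: w) = b * fib (size w).+2 + fib_value w.
Proof.
rewrite /fib_value /= big_ord_recr /= rev_cons nth_rcons size_rev ltnn eqxx.
rewrite addn2 addnC; congr (_ + _); apply: eq_bigr => j _.
by rewrite nth_rcons size_rev ltn_ord.
Qed.

Lemma no11_cons b (w : word) : infix [:: true; true] (b :: w) =
  (b && head false w) || infix [:: true; true] w.
Proof. by case: b; case: w => [|[] w] //=; rewrite ?prefix0s. Qed.

Lemma fib_rep_padded k n : n < fib k.+2 ->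
  exists w : word, [/\ size w = k, ~~ infix [:: true; true] w & fib_value w = n].
Proof.
have [m] := ubnP k; elim: m k n => // m IH [|[|k]] n le_k lt_n.
- exists [::]; split=> //; rewrite /fib_value big_ord0; move: lt_n => /=; lia.
- exists [:: n == 1]; split=> //; first by case: (n == 1).
  by rewrite fib_value_cons /fib_value big_ord0; move: lt_n => /=; lia.
case: (ltnP n (fib k.+3)) => [lt_n'|le_n].
  have [|w [sz_w no11 val_w]] := IH k.+1 n _ lt_n'; first by lia.
  by exists (false :: w); split; rewrite /= ?sz_w ?no11_cons ?fib_value_cons ?val_w.
have lt_n' : n - fib k.+3 < fib k.+2 by rewrite fibSS in lt_n; lia.
have [|w [sz_w no11 val_w]] := IH k _ _ lt_n'; first by lia.
exists [:: true, false & w]; split; first by rewrite /= sz_w.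
  by rewrite !no11_cons.
by rewrite !fib_value_cons val_w [size _]/= sz_w; lia.
Qed.

Lemma fib_gt n : n < fib n.+2.
Proof.
have fib_gt0 k : 0 < fib k.+1 by elim: k => // k IH; rewrite fibSS addn_gt0 IH.
by elim: n => // n IH; rewrite fibSS; have := fib_gt0 n; lia.
Qed.

Lemma canonical_fib_rep_exists n : exists w, canonical_fib_rep n w.
Proof.
have [w [_ no11 <-]] := fib_rep_padded (fib_gt n).
elim: w no11 => [|[] w IH] no11.
- by exists [::]; rewrite /canonical_fib_rep eqxx.
- by exists (true :: w); rewrite /canonical_fib_rep no11 eqxx.
have [|w' repw'] := IH; first by move: no11; rewrite no11_cons.
by exists w'; rewrite fib_value_cons.
Qed.

Lemma fib_value_lt (w : word) : ~~ infix [:: true; true] w -> fib_value w < fib (size w).+2.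
Proof.
have [m] := ubnP (size w); elim: m w => // m IH [|a w] le_w.
  by rewrite /fib_value big_ord0.
rewrite no11_cons negb_or fib_value_cons => /andP[hd no11].
have lt_w : size w < m by [].
have E := fibSS (size w).+1; rewrite [size (_ :: _)]/= {le_w}.
case: a hd => hd; last by have := IH w lt_w no11; rewrite mul0n; lia.
case: w lt_w hd no11 E => [|[] w] // lt_w _; first by rewrite /fib_value big_ord0.
rewrite no11_cons fib_value_cons [size (_ :: _)]/= => no11.
by have := IH w (ltnW lt_w) no11; rewrite mul0n mul1n; lia.
Qed.

Lemma fib_rep_inj (v w : word) : size v = size w ->
  ~~ infix [:: true; true] v -> ~~ infix [:: true; true] w ->
  fib_value v = fib_value w -> v = w.
Proof.
elim: v w => [|a v IH] [|b w] // [sz_vw].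
rewrite !no11_cons !negb_or !fib_value_cons sz_vw => /andP[_ nv] /andP[_ nw].
have := fib_value_lt nv; have := fib_value_lt nw; rewrite sz_vw.
by case: a; case: b; rewrite ?mul0n ?mul1n => ? ? E; try lia; congr (_ :: _); apply: IH => //; lia.
Qed.

Lemma canonical_fib_rep_unique n v w :
  canonical_fib_rep n v -> canonical_fib_rep n w -> v = w.
Proof.
have fib_mono a b : a <= b -> fib a.+1 <= fib b.+1.
  by move=> /subnKC <-; elim: (b - a) => [|d]; rewrite ?addn0 // addnS fibSS; lia.
have aux (v' w' : word) : head true v' -> head true w' ->
    ~~ infix [:: true; true] v' -> fib_value v' = fib_value w' ->
    size w' <= size v'.
  case: w' => [|[] w'] //= hv _ nv E.
  have lt_v := fib_value_lt nv; rewrite leqNgt; apply/negP => lt_vw.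
  have := @fib_mono (size v').+1 (size w').+1; rewrite fib_value_cons in E; lia.
case/and3P=> hv nv /eqP Ev /and3P[hw nw /eqP Ew].
apply: fib_rep_inj => //; last by rewrite Ev Ew.
by apply/eqP; rewrite eqn_leq !aux // Ev Ew.
Qed.

(* The Zeckendorf representation [(n)_F]. *)
Definition fib_rep (n : nat) : word := xchoose (canonical_fib_rep_exists n).

(* [w] is in the language of the regular expression [(x)^+ y]. *)
Definition in_plus_cat (x y w : word) : Prop :=
  exists k, 0 < k /\ w = flatten (nseq k x) ++ y.

(* Main.v *)
(* Write [f_k] for the prefix of length [F_k] of the Fibonacci word [f] and call
   [n] good if a cube ends at [n].  The long runs of zeros in [cubes_f] turn out
   to be those beginning at [F_k - 7] with [k >= 8] (length 8 for even [k] and 7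
   for odd [k]), and the Zeckendorf representations of these numbers are the
   stated ones.

   Since [f_(k+1) f_k] and [f_k f_(k+1)] agree except in their last two letters,
   [f[F_k + t] = f[t]] for [t < F_(k+1) - 2].  Hence good positions
   [n < F_(k+1) - 2] yield good positions [F_k + n].  This, a table of the first
   good positions and the cubes of order [F_a] in the stretch of period [F_a]
   beginning at [F_(a+1)] give, by induction, good positions in every window of
   length 7 not contained in one of these runs or in the 13 initial zeros.

   That no cube ends in [[F_k - 7, F_k - 1]] (nor at [F_k] if [k] is even) follows
   from the fact that [f_k] without its last two letters is a palindrome: a cube of
   order [p] ending there is reflected to a stretch of period [p] covering at least
   [t = 4, ..., 2p - 4] near the beginning of [f].  The translation property turns
   a period [p] with [F_m < p < F_(m+1)] into one of the smaller periods [p - F_m]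
   and [F_(m+1) - p], so such a stretch does not exist when [p > 3], and periods at
   most 3 are found in the table. *)
Require Import Defs.
From mathcomp Require Import all_boot.
From mathcomp Require Import boolp zify.

Set Implicit Arguments.
Unset Strict Implicit.
Unset Printing Implicit Defensive.

Arguments fib : simpl never.

Local Notation f := fibonacci_word.

(** * Growth of the Fibonacci numbers *)

Lemma fib_mono : {homo fib : a b / a <= b}.
Proof.
have fib_leS n : fib n <= fib n.+1 by case: n => // n; rewrite fibSS leq_addr.
by move=> a b /subnKC <-; elim: (b - a) => [|d IH]; rewrite ?addn0 // addnS (leq_trans IH).
Qed.

Lemma fib_lt_inv a b : fib a < fib b -> a < b.
Proof. by apply: contraTltn; rewrite -leqNgt; apply: fib_mono. Qed.

Lemma fib_bracket n : exists k, fib k <= n < fib k.+1.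
Proof.
have ex : exists k, n < fib k.+1 by exists n.+1; exact: fib_gt.
case: (ex_minnP ex) => -[|k] lt_n min_k; first by exists 0.
by exists k.+1; rewrite lt_n leqNgt andbT; apply/negP=> /min_k; rewrite ltnn.
Qed.

(** * Translation, reflection and periods of the Fibonacci word *)

Lemma fibonacci_iterSS k :
  fibonacci_iter k.+2 = fibonacci_iter k.+1 ++ fibonacci_iter k.
Proof.
elim: k => // k IH.
by rewrite /fibonacci_iter iterS -/(fibonacci_iter _) {1}IH fib_morphism_cat.
Qed.

Lemma size_fibonacci_iterE k : size (fibonacci_iter k) = fib k.+2.
Proof.
elim/ltn_ind: k => -[|[|k]] // IH.
by rewrite fibonacci_iterSS size_cat !IH // [in RHS]fibSS.
Qed.

Lemma fibonacci_word_concat k t :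
  t < fib k.+2 -> f (fib k.+3 + t) = f t.
Proof.
move=> lt_t; rewrite [RHS](@fibonacci_wordE k) ?size_fibonacci_iterE //.
rewrite (@fibonacci_wordE k.+2) ?size_fibonacci_iterE; last by rewrite (fibSS k.+2) ltn_add2l.
by rewrite fibonacci_iterSS nth_cat size_fibonacci_iterE ltnNge leq_addr addKn.
Qed.

(* [f_k f_(k-1)] and [f_(k-1) f_k] differ only in their last two letters. *)
Lemma fibonacci_word_shift k t : t.+2 < fib k.+1 -> f (fib k + t) = f t.
Proof.
elim/ltn_ind: k t => -[|[|[|k]]] IH t // lt_t.
case: (ltnP t (fib k.+2)) => [|le_t]; first exact: fibonacci_word_concat.
rewrite -(subnKC le_t) addnA -fibSS.
rewrite (@fibonacci_word_concat k.+1) ?IH //; rewrite fibSS in lt_t; lia.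
Qed.

(** The prefix of length F_(k+2) ends with the one of length F_k, so the last two letters alternate
    between 01 and 10. *)
Lemma fibonacci_word_penultimate k :
  (f (fib k.+3 - 2) = odd k) * (f (fib k.+3 - 1) = ~~ odd k).
Proof.
elim/ltn_ind: k => -[|[|k]] IH //.
have ge2 : 2 <= fib k.+3 by apply: (@fib_mono 3).
have [E2 E1] := IH k (leqnSn _); have E := fibSS k.+3; rewrite [odd _]/= negbK.
have stepE j : 0 < j <= 2 -> f (fib k.+4.+1 - j) = f (fib k.+3 - j).
  move=> j_in; rewrite (_ : fib k.+4.+1 - j = fib k.+4 + (fib k.+3 - j)); last by lia.
  by apply: fibonacci_word_concat; lia.
by rewrite !stepE ?E1.
Qed.

(** The bound in [fibonacci_word_shift] is sharp; this excludes the Fibonacci numbers themselves as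
    periods. *)
Lemma fibonacci_word_mismatch k :
  f (fib k.+3 - 2 + fib k.+2) != f (fib k.+3 - 2).
Proof.
have ge2 : 2 <= fib k.+3 by apply: (@fib_mono 3).
rewrite (_ : _ + _ = fib k.+4 - 2); last by rewrite (fibSS k.+2); lia.
by rewrite !fibonacci_word_penultimate /=; case: odd.
Qed.

Lemma fibonacci_word_palindrome k t :
  t.+3 <= fib k -> f (fib k - 3 - t) = f t.
Proof.
elim/ltn_ind: k t => -[|[|[|[|[|k]]]]] IH t lt_t //.
- by case: t lt_t => [|[|]].
have E := fibSS k.+3; have ge2 : 2 <= fib k.+3 by apply: (@fib_mono 3).
have E' := fibSS k.+2; move: lt_t => le_t.
(* The mirror image of t lies in the final copy of f_(k+3). The next two letters end f_(k+3) and
   mirror to the last two of f_(k+4), which are in the opposite order. Later letters are translates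
   by F_(k+3) of the palindrome in f_(k+4). *)
have [lt_t|le_t'] := ltnP t (fib k.+3 - 2).
  rewrite (_ : _ - t = fib k.+4 + (fib k.+3 - 3 - t)); last by lia.
  by rewrite fibonacci_word_concat ?IH //; lia.
have [lt_t|{}le_t'] := ltnP t (fib k.+3).
  have [->|->] : t = fib k.+3 - 2 \/ t = fib k.+3 - 1 by lia.
    rewrite (_ : _ - _ = fib k.+4 - 1); last by lia.
    by rewrite !fibonacci_word_penultimate /= negbK.
  rewrite (_ : _ - _ = fib k.+4 - 2); last by lia.
  by rewrite !fibonacci_word_penultimate.
rewrite -(subnKC le_t') fibonacci_word_shift; last by lia.
by rewrite -[RHS](IH k.+4) //; [congr f|]; lia.
Qed.

Lemma fibonacci_word_aperiodic p : 3 < p ->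
  exists2 t, 4 <= t < 2 * p - 3 & f t != f (t + p).
Proof.
elim/ltn_ind: p => p IH lt3p.
have [lt_p8|le8p] := ltnP p 8.
  by case: p lt_p8 lt3p {IH} => [|[|[|[|[|[|[|[|]]]]]]]] // _ _;
    [exists 4 | exists 6 | exists 4 | exists 4].
have [m /andP[le_m lt_m]] := fib_bracket p.
have lt5m : 5 < m by rewrite -ltnS; apply: fib_lt_inv; exact: leq_ltn_trans lt_m.
case: m le_m lt_m lt5m => [|[|m]] // le_m lt_m lt3m.
have E3 := fibSS m.+1; have E2 := fibSS m; have E4 := fibSS m.+2.
have ge3 : 3 <= fib m by apply: (@fib_mono 4).
have ge5 : 5 <= fib m.+1 by apply: (@fib_mono 5).
apply: contrapT => nex.
have per t : 4 <= t < 2 * p - 3 -> f t = f (t + p).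
  by move=> t_in; apply/eqP; apply: contrapT => /negP ne; apply: nex; exists t.
(* No r < p is a period on [4, N): the induction hypothesis applies if r > 3, and t = 4 or 6 refutes
   r <= 3, with N >= 9 leaving room for 6 + 2. *)
have small r N : 0 < r -> 3 * r <= N.+2 -> 9 <= N ->
    (forall t, 4 <= t -> t + r < N -> f t = f (t + r)) -> r < p -> False.
  move=> r_gt0 le_rN le9N eq_r lt_rp.
  have [le_r3|lt3r] := leqP r 3.
    have := eq_r 4; have := eq_r 6.
    case: r r_gt0 le_r3 {le_rN eq_r lt_rp} => [|[|[|[|]]]] // _ _ e6 e4.
    - by have : f 4 = f (4 + 1) by apply: e4; lia.
    - by have : f 6 = f (6 + 2) by apply: e6; lia.
    - by have : f 4 = f (4 + 3) by apply: e4; lia.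
  have [t t_in /eqP[]] := IH r lt_rp lt3r; apply: eq_r; lia.
have [eq_p|ne_p] := eqVneq p (fib m.+2).
  have /eqP[] := fibonacci_word_mismatch m; rewrite -eq_p; symmetry; apply: per; lia.
(* Combining the period p with a translation by F_(m+2) or F_(m+3) gives the period p - F_(m+2) or
   F_(m+3) - p; at least one of them is short enough for [small]. *)
have [le_r|lt_r] := leqP (3 * (p - fib m.+2)) (fib m.+3).
  apply: (small (p - fib m.+2) (fib m.+3 - 2)); try lia.
  move=> t le4t lt_t; rewrite per; last by lia.
  rewrite (_ : t + p = fib m.+2 + (t + (p - fib m.+2))); last by lia.
  by apply: fibonacci_word_shift; lia.
apply: (small (fib m.+3 - p) (fib m.+3)); try lia.
move=> t le4t lt_t; rewrite [RHS]per; last by lia.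
rewrite (_ : _ + p = fib m.+3 + t); last by lia.
by symmetry; apply: fibonacci_word_shift; lia.
Qed.

(** * Cubes as periodic stretches, and a table of the first ones *)

Definition cube_ends_at_with_period (u : infword) (p j : nat) : bool :=
  (3 * p <= j.+1) && all (fun t => u t == u (t + p)) (iota (j.+1 - 3 * p) (2 * p)).

Lemma cube_ends_at_with_periodP (u : infword) p i j : j.+1 = i + 3 * p ->
  reflect (forall t, i <= t < i + 2 * p -> u t = u (t + p))
          (cube_ends_at_with_period u p j).
Proof.
move=> Ej; rewrite /cube_ends_at_with_period Ej leq_addl addnK.
by apply: (iffP allP) => eq_u t => [t_in|]; [apply/eqP/eq_u|rewrite mem_iota => /eq_u ->];
  rewrite ?mem_iota.
Qed.

Lemma cube_ends_atP (u : infword) j :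
  cube_ends_at u j <-> exists2 p, 0 < p & cube_ends_at_with_period u p j.
Proof.
split=> [[i [m [x [m_gt0 Ej sz_x]]]] | [p p_gt0 cube_p]].
  have Ej' : j.+1 = i + 3 * m by lia.
  rewrite /factor (_ : j.+1 - i = m + (m + m)); last by lia.
  rewrite !iotaD !map_cat => /eqP.
  rewrite !eqseq_cat ?size_map ?size_iota // => /and3P[/eqP E0 /eqP E1 /eqP E2].
  have nthE a t : t < m -> nth false [seq u k | k <- iota a m] t = u (a + t).
    by move=> lt_t; rewrite (nth_map 0) ?size_iota // nth_iota.
  exists m => //; apply/(cube_ends_at_with_periodP _ Ej') => t t_in.
  have [lt_t|le_t] := ltnP t (i + m).
    have := congr1 (nth false ^~ (t - i)) (etrans E0 (esym E1)); rewrite !nthE; try lia.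
    by rewrite addnAC subnKC //; lia.
  have := congr1 (nth false ^~ (t - (i + m))) (etrans E1 (esym E2)); rewrite !nthE; try lia.
  by rewrite [i + m + m + _]addnAC subnKC.
have [i Ej] : exists i, j.+1 = i + 3 * p.
  by have /andP[le_p _] := cube_p; exists (j.+1 - 3 * p); rewrite subnK.
have /cube_ends_at_with_periodP-/(_ _ Ej) eq_u := cube_p.
exists i, p, (mkseq (fun t => u (i + t)) p); split=> //; first by lia.
  by rewrite size_mkseq.
rewrite /factor (_ : j.+1 - i = p + (p + p)); last by lia.
have mapE a : [seq u k | k <- iota a p] = mkseq (fun t => u (a + t)) p.
  by rewrite -[a in LHS]addn0 iotaDl -map_comp.
rewrite !iotaD !map_cat !mapE.
have E1 : mkseq (fun t => u (i + p + t)) p = mkseq (fun t => u (i + t)) p.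
  apply: (@eq_from_nth _ false) => [|t]; rewrite !size_mkseq // => lt_t.
  by rewrite !nth_mkseq // addnAC -eq_u //; lia.
have E2 : mkseq (fun t => u (i + p + p + t)) p = mkseq (fun t => u (i + p + t)) p.
  apply: (@eq_from_nth _ false) => [|t]; rewrite !size_mkseq // => lt_t.
  by rewrite !nth_mkseq // addnAC -eq_u //; lia.
by rewrite E2 E1.
Qed.

Lemma cubes_fP j : reflect (exists2 p, 0 < p & cube_ends_at_with_period f p j) (cubes_f j).
Proof. by rewrite /cubes_f; apply: (iffP (asboolP _)) => /cube_ends_atP. Qed.

Lemma eq_cube_ends_at_with_period (u v : infword) p j :
  (forall t, t <= j -> u t = v t) ->
  cube_ends_at_with_period u p j = cube_ends_at_with_period v p j.
Proof.
move=> eq_uv; rewrite /cube_ends_at_with_period; case: leqP => //= le_p.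
by apply: eq_in_all => t; rewrite mem_iota => t_in; rewrite !eq_uv //; lia.
Qed.

Lemma cube_ends_at_with_period_addn (u : infword) p j d : 3 * p <= j.+1 ->
  cube_ends_at_with_period u p (d + j) =
  cube_ends_at_with_period (fun t => u (d + t)) p j.
Proof.
move=> le_p; rewrite /cube_ends_at_with_period le_p -addnS -addnBA //.
rewrite (leq_trans le_p) ?leq_addl //= iotaDl all_map; apply: eq_all => t /=.
by rewrite addnA.
Qed.

(** The table extends to 64 = F_10 + 9, the largest base case needed for the translations below. *)
Lemma cubes_f_lt65 n : n < 65 -> cubes_f n =
  (n \in [:: 13; 22; 23; 26; 34; 36; 37; 38; 39; 43; 44; 47; 56; 57; 59; 60; 61; 62; 63; 64]).
Proof.
move=> lt_n; pose u := nth false (fibonacci_iter 9).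
have f_u p : cube_ends_at_with_period f p n = cube_ends_at_with_period u p n.
  apply: eq_cube_ends_at_with_period => t t_le; apply: fibonacci_wordE.
  by rewrite size_fibonacci_iterE (_ : fib 11 = 89) //; lia.
have -> : cubes_f n = has (cube_ends_at_with_period u ^~ n) (iota 1 n).
  apply/cubes_fP/hasP => -[p]; last by rewrite mem_iota -f_u => /andP[p_gt0 _]; exists p.
  move=> p_gt0 cube_p; have /andP[le_p _] := cube_p.
  by exists p; rewrite ?mem_iota -?f_u //; lia.
have /allP/(_ n) : all (fun n => has (cube_ends_at_with_period u ^~ n) (iota 1 n) ==
    (n \in [:: 13; 22; 23; 26; 34; 36; 37; 38; 39; 43; 44; 47; 56; 57; 59; 60; 61; 62; 63; 64]))
    (iota 0 65) by vm_compute.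
by rewrite mem_iota => /(_ lt_n)/eqP.
Qed.

(** * Translating cubes *)

Lemma cube_ends_at_with_period_shift k p n : 3 * p <= n.+1 -> n.+2 < fib k.+1 ->
  cube_ends_at_with_period f p (fib k + n) = cube_ends_at_with_period f p n.
Proof.
move=> le_p lt_n; rewrite cube_ends_at_with_period_addn //.
by apply: eq_cube_ends_at_with_period => t t_le; apply: fibonacci_word_shift; lia.
Qed.

(** F_(k+2r) - F_k is the sum F_(k+1) + F_(k+3) + ... + F_(k+2r-1), so the shift is a chain of
    single translations. It carries positions near F_k to positions near a Fibonacci number of the
    same parity of index. *)
Lemma cube_ends_at_with_period_shift2 k r p n : 3 * p <= n.+1 -> n.+2 < fib k.+2 ->
  cube_ends_at_with_period f p (fib (k + r.*2) - fib k + n) =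
  cube_ends_at_with_period f p n.
Proof.
move=> le_p lt_n; elim: r => [|r IH]; first by rewrite addn0 subnn.
have le0 : fib k <= fib (k + r.*2) by apply: fib_mono; rewrite leq_addr.
have le1 : fib k.+1 <= fib (k + r.*2).+1 by apply: fib_mono; rewrite ltnS leq_addr.
rewrite doubleS !addnS -IH; have := fibSS (k + r.*2); have := fibSS k => E E'.
rewrite (_ : _ + n = fib (k + r.*2).+1 + (fib (k + r.*2) - fib k + n)); last by lia.
by apply: cube_ends_at_with_period_shift; lia.
Qed.

Lemma cubes_f_shift k n : n.+2 < fib k.+1 -> cubes_f n -> cubes_f (fib k + n).
Proof.
move=> lt_n /cubes_fP[p p_gt0 cube_p]; apply/cubes_fP; exists p => //.
by have /andP[le_p _] := cube_p; rewrite cube_ends_at_with_period_shift.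
Qed.

Lemma cubes_f_shift2 k r n : n.+2 < fib k.+2 ->
  cubes_f n -> cubes_f (fib (k + r.*2) - fib k + n).
Proof.
move=> lt_n /cubes_fP[p p_gt0 cube_p]; apply/cubes_fP; exists p => //.
by have /andP[le_p _] := cube_p; rewrite cube_ends_at_with_period_shift2.
Qed.

Lemma subn_half_double a b : a <= b -> odd a = odd b -> b = a + ((b - a)./2).*2.
Proof. by move=> le_ab eq_odd; rewrite even_halfK ?oddB ?eq_odd ?addbb // subnKC. Qed.

(** * Good positions and gaps around Fibonacci numbers *)

Lemma cubes_f_near_fib_false k d : 8 <= k -> d <= 7 -> (d == 0) ==> ~~ odd k ->
  cubes_f (fib k - d) = false.
Proof.
move=> le8k le_d7 d0; have le21 : 21 <= fib k by apply: (@fib_mono 8).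
apply/cubes_fP => -[p p_gt0 cube_p]; have /andP[le_p _] := cube_p.
have [le_p3|lt3p] := leqP p 3; last first.
  have [t t_in /eqP[]] := fibonacci_word_aperiodic lt3p.
  have Ej : (fib k - d).+1 = (fib k - d).+1 - 3 * p + 3 * p by rewrite subnK.
  have eq_f := elimT (cube_ends_at_with_periodP _ Ej) cube_p.
  (* Reflected, the cube gives f t = f (t + p) for d - 3 <= t <= 2p + d - 4. For every d from 0 to 7
     this includes 4 <= t < 2p - 3. *)
  rewrite -(@fibonacci_word_palindrome k t) -?(@fibonacci_word_palindrome k (t + p)); try lia.
  rewrite [RHS]eq_f; last by lia.
  by congr f; lia.
(* A cube of order at most 3 is short enough to be carried down next to F_8 or F_9, where the table
   has none. *)
pose b := if odd k then 9 else 8.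
have lt_b : fib b <= fib k /\ b <= k by split; [apply: fib_mono|]; rewrite /b; case: ifP; lia.
have Ek : k = b + ((k - b)./2).*2.
  by apply: subn_half_double; [lia | rewrite /b; case: (odd k)].
have fib_b : fib b - d < 65 /\ 14 <= fib b - d /\ (fib b - d).+2 < fib b.+2.
  by rewrite /b; case: (odd k); rewrite /fib; lia.
have : cube_ends_at_with_period f p (fib b - d).
  rewrite -(@cube_ends_at_with_period_shift2 b ((k - b)./2)) -?Ek; try lia.
  by rewrite (_ : _ + _ = fib k - d) //; lia.
move=> cube_b; have : cubes_f (fib b - d) by apply/cubes_fP; exists p.
rewrite cubes_f_lt65; last by lia.
rewrite /b; move: d (odd k) d0 le_d7 {fib_b cube_b cube_p le_p} => d [] d0; move: d d0.
  by move=> [|[|[|[|[|[|[|[|]]]]]]]].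
by move=> [|[|[|[|[|[|[|[|]]]]]]]].
Qed.

Lemma cubes_f_fib_addn b k e : e.+2 < fib b.+1 -> b <= k -> odd b = odd k ->
  cubes_f (fib b + e) -> cubes_f (fib k + e).
Proof.
move=> lt_e le_bk eq_odd; have Ek := subn_half_double le_bk eq_odd.
move/(@cubes_f_shift2 b ((k - b)./2)); rewrite -Ek addnA subnK; last exact: fib_mono.
by apply; have := fibSS b; lia.
Qed.

(** This position and the one in [cubes_f_fib_odd] terminate the runs of length 8 and 7. *)
Lemma cubes_f_fib_even k : 8 <= k -> ~~ odd k -> cubes_f (fib k + 1).
Proof.
move=> le8k even_k; apply: (@cubes_f_fib_addn 8) => //; first by rewrite (negbTE even_k).
by rewrite cubes_f_lt65.
Qed.

Lemma cubes_f_fib_odd k : 9 <= k -> odd k -> cubes_f (fib k).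
Proof.
move=> le9k odd_k; rewrite -[fib k]addn0; apply: (@cubes_f_fib_addn 9) => //.
by rewrite cubes_f_lt65.
Qed.

Lemma ltn_neq_odd a b : a <= b -> odd a != odd b -> a < b.
Proof. by move=> le_ab; rewrite ltn_neqAle le_ab andbT; apply: contraNneq => ->. Qed.

Lemma cubes_f_fib_25 k e : 8 <= k -> e \in [:: 2; 5] -> cubes_f (fib k + e).
Proof.
move=> le8k e_in; case odd_k : (odd k); move: e_in.
  have le9k : 9 <= k by apply: ltn_neq_odd; rewrite ?odd_k.
  by rewrite !inE => /orP[] /eqP ->; apply: (@cubes_f_fib_addn 9);
    rewrite ?odd_k ?cubes_f_lt65.
by rewrite !inE => /orP[] /eqP ->; apply: (@cubes_f_fib_addn 8);
  rewrite ?odd_k ?cubes_f_lt65.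
Qed.

(** k = 8 fails: 21 + 9 = 30 lies in the run beginning at F_9 - 7 = 27. *)
Lemma cubes_f_fib_9 k : 9 <= k -> cubes_f (fib k + 9).
Proof.
move=> le9k; case odd_k : (odd k).
  by apply: (@cubes_f_fib_addn 9); rewrite ?odd_k ?cubes_f_lt65.
have lt9k : 9 < k by apply: ltn_neq_odd; rewrite ?odd_k.
by apply: (@cubes_f_fib_addn 10); rewrite ?odd_k ?cubes_f_lt65.
Qed.

Lemma cubes_f_fib_sub8 k : 8 <= k -> cubes_f (fib k - 8).
Proof.
move=> le8k; pose b := if odd k then 9 else 8.
have le_bk : b <= k by rewrite /b; case: ifP => // odd_k; apply: ltn_neq_odd; rewrite ?odd_k.
have eq_odd : odd b = odd k by rewrite /b; case: (odd k).
have le8b : 8 <= fib b by rewrite /b; case: ifP.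
have := @cubes_f_shift2 b ((k - b)./2) (fib b - 8).
rewrite -subn_half_double // addnBA // subnK ?fib_mono //; apply.
  by have := fibSS b; lia.
by rewrite /b cubes_f_lt65; case: ifP.
Qed.

(** The translate by F_k of the run beginning at F_m - 7 is not a long run, because this position
    interrupts it. *)
Lemma cubes_f_two_fib m k : 8 <= m -> m.+2 <= k -> cubes_f (fib k + fib m - 3).
Proof.
have base a : 6 <= a -> cubes_f (fib a.+3 + fib a - 3).
  case: a => // a le6a; have le5a : 5 <= fib a by apply: (@fib_mono 5).
  have le8a : 8 <= fib a.+1 by apply: (@fib_mono 6).
  have [E1 E2 E3] : [/\ fib a.+2 = fib a.+1 + fib a, fib a.+3 = fib a.+2 + fib a.+1
    & fib a.+4 = fib a.+3 + fib a.+2] by [].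
  apply/cubes_fP; exists (fib a.+1); first by lia.
  (* With s = t - F_(a+2), the letters at t and t + F_(a+1) are the translates of f s by F_(a+2) and
     F_(a+3). The start i is the last one for which s + 2 < F_(a+3) holds throughout. *)
  pose i := fib a.+2 + fib a - 2.
  apply/(@cube_ends_at_with_periodP _ _ i); first by rewrite /i; lia.
  move=> t; rewrite /i => t_in; rewrite -(subnKC (_ : fib a.+2 <= t)); last by lia.
  rewrite addnAC -fibSS !fibonacci_word_shift //; lia.
case: m => [|[|m]] // le8m le_mk; have le8 : 8 <= fib m by apply: (@fib_mono 6).
have [E1 E2 E3] : [/\ fib m.+2 = fib m.+1 + fib m, fib m.+3 = fib m.+2 + fib m.+1
    & fib m.+4 = fib m.+3 + fib m.+2] by [].
have shift b : m.+4 <= b -> b <= k -> odd b = odd k -> cubes_f (fib b + fib m.+2 - 3) ->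
    cubes_f (fib k + fib m.+2 - 3).
  move=> le_b le_bk eq_odd; have le3 : 3 <= fib m.+2 by lia.
  rewrite -!(addnBA _ le3).
  apply: cubes_f_fib_addn => //; have : fib m.+3 <= fib b.-1 by apply: fib_mono; lia.
  by case: b le_b {le_bk eq_odd} => // b le_b; rewrite (fibSS b) /=; lia.
(* Parity reduces k to m + 4 or m + 5. The former is a translate by F_(m+3) of [base m], the latter
   is [base m.+2]. *)
have [eq_odd|ne_odd] := eqVneq (odd m) (odd k).
  apply: (shift m.+4) => //; first by rewrite /= !negbK.
  rewrite (_ : _ - 3 = fib m.+3 + (fib m.+3 + fib m - 3)); last by lia.
  by apply: cubes_f_shift; [lia | apply: base].
apply: (shift m.+4.+1) => //.
- by apply: ltn_neq_odd; rewrite //= !negbK.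
- by rewrite /= !negbK; case: (odd m) (odd k) ne_odd => [] [].
by apply: base; lia.
Qed.

(** The second alternative is the other window of length 7 in a run of length 8; [6 < n] avoids
    windows inside the 13 initial zeros. *)
Lemma cubes_f_gap n : 6 < n -> (forall d, d <= 6 -> ~~ cubes_f (n + d)) ->
  exists2 k, 8 <= k & n + 7 = fib k \/ n + 6 = fib k.
Proof.
elim/ltn_ind: n => n IH lt6n gap.
have noncube j : n <= j <= n + 6 -> ~~ cubes_f j.
  by move=> j_in; rewrite -(@subnKC n j); [apply: gap|]; lia.
have [lt_n|le_n] := ltnP n 21.
  have : [|| n <= 13, n == 14, n == 15 | 16 <= n] by lia.
  case/or4P=> [le_n|/eqP->|/eqP->|le_n]; last 1 first.
  - by have /negP[] : ~~ cubes_f 22; [apply: noncube; lia | rewrite cubes_f_lt65].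
  - by have /negP[] : ~~ cubes_f 13; [apply: noncube; lia | rewrite cubes_f_lt65].
  - by exists 8; [|left].
  - by exists 8; [|right].
have [k /andP[le_k lt_k]] := fib_bracket n.
have le8k : 8 <= k by rewrite -ltnS; apply: fib_lt_inv; exact: leq_ltn_trans lt_k.
have : fib 6 <= fib k.-2 by apply: fib_mono; lia.
rewrite (_ : fib 6 = 8) //; case: k le_k lt_k le8k => [|[|k]] // le_k lt_k le8k /= le8.
have [E1 E2] : fib k.+2 = fib k.+1 + fib k /\ fib k.+3 = fib k.+2 + fib k.+1 by [].
(* Translation preserves good positions, so the window moved back by F_(k+2) is again a gap, ending
   near some F_m. Only m = k + 1 survives, and F_(k+2) + F_(k+1) = F_(k+3). *)
have [lt6|le6] := ltnP 6 (n - fib k.+2).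
  have [||d le_d|m le8m Em] := IH (n - fib k.+2); try lia.
    apply: contra (noncube (n + d) _); last by lia.
    move/(@cubes_f_shift k.+2); rewrite addnA subnKC //; apply; lia.
  have [le_m|lt_m] := leqP m.+2 k.+2.
    have /negP[] := noncube (fib k.+2 + fib m - 3) ltac:(lia).
    exact: cubes_f_two_fib.
  have [lt_mk|le_mk] := ltnP m k.+2; last by have := fib_mono le_mk; lia.
  have Emk : m = k.+1 by lia.
  by exists k.+3; [lia | rewrite Emk in Em; lia].
(* For n - F_(k+2) <= 6 the window meets one of the offsets 2, 5, 9, except when n = 27 = F_9 -
   7. *)
have [le2|lt2] := leqP n (fib k.+2 + 2).
  by have /negP[] := noncube (fib k.+2 + 2) ltac:(lia); apply: cubes_f_fib_25.
have [le5|lt5] := leqP n (fib k.+2 + 5).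
  by have /negP[] := noncube (fib k.+2 + 5) ltac:(lia); apply: cubes_f_fib_25.
have [eq8|ne8] := eqVneq k 6.
  by subst k; exists 9 => //; left; move: lt5 le6;
    rewrite (_ : fib 8 = 21) // (_ : fib 9 = 34) //; lia.
have /negP[] := noncube (fib k.+2 + 9) ltac:(lia); apply: cubes_f_fib_9; lia.
Qed.

(** * The runs of length 7 and 8 *)

Lemma long_zero_runP len i : 7 <= len <= 8 ->
  zero_run cubes_f len i <-> exists k, [/\ 8 <= k, i + 7 = fib k & odd k = (len == 7)].
Proof.
move=> len_in; split=> [[_ run0 run1 left1] | [k [le8k Ei odd_k]]].
  (* If i <= 6, either i = 0 and the run would end inside the 13 initial zeros, or the left
     neighbour is one of them. *)
  have lt6i : 6 < i.
    rewrite ltnNge; apply/negP => le_i6; case: left1 => [i0|]; last first.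
      by rewrite cubes_f_lt65; move: i le_i6 {run0 run1} => [|[|[|[|[|[|[|]]]]]]].
    have [L7|L8] : len = 7 \/ len = 8 by lia.
      by move: run1; rewrite i0 L7 cubes_f_lt65.
    by move: run1; rewrite i0 L8 cubes_f_lt65.
  have [d le_d|k le8k [Ek|Ek]] := cubes_f_gap lt6i; first by rewrite run0 //; lia.
    exists k; split=> //; case odd_k : (odd k).
      apply/esym/eqP; have [//|L8] : len = 7 \/ len = 8 by lia.
      have := run0 7; rewrite L8 Ek cubes_f_fib_odd //; first by move/(_ isT).
      by apply: ltn_neq_odd; rewrite ?odd_k.
    apply/esym/eqP => L7; move: run1; rewrite L7 Ek -[fib k]subn0.
    by rewrite cubes_f_near_fib_false ?odd_k.
  case: left1 => [|]; first by lia.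
  by rewrite (_ : i - 1 = fib k - 7) ?cubes_f_near_fib_false //; lia.
have lt21 : 21 <= fib k by apply: (@fib_mono 8).
split; first by lia.
- move=> t lt_t; rewrite (_ : i + t = fib k - (7 - t)); last by lia.
  apply: cubes_f_near_fib_false => //; first by lia.
  by apply/implyP => ?; rewrite odd_k; lia.
- have [L7|L8] : len = 7 \/ len = 8 by lia.
    by rewrite L7 Ei cubes_f_fib_odd ?odd_k ?L7 //; apply: ltn_neq_odd; rewrite ?odd_k ?L7.
  by rewrite L8 (addnA i 7 1) Ei cubes_f_fib_even // odd_k L8.
- by right; rewrite (_ : i - 1 = fib k - 8) ?cubes_f_fib_sub8 //; lia.
Qed.

(** * Zeckendorf representations of F_k - 7 *)

Lemma fib_repP n w : fib_rep n = w <-> canonical_fib_rep n w.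
Proof.
have rep_n : canonical_fib_rep n (fib_rep n) by apply: xchooseP.
by split=> [<-|] //; apply: canonical_fib_rep_unique.
Qed.

(** Prefixing 10 to w adds F_(|w|+3), so a value F_(|w|+2) - c becomes F_(|w|+4) - c with the same
    deficit c. *)
Lemma in_plus_10_fib_rep (y : word) c n :
  ~~ infix [:: true; true] y -> fib_value y + c = fib (size y).+2 ->
  in_plus_cat [:: true; false] y (fib_rep n) <->
  exists2 k, 0 < k & n + c = fib (k.*2 + (size y).+2).
Proof.
move=> no11_y val_y; pose w k : word := flatten (nseq k [:: true; false]) ++ y.
have size_w k : size (w k) = k.*2 + size y by elim: k => //= k ->.
have no11_w k : ~~ infix [:: true; true] (w k) by elim: k => //= k IH; rewrite !no11_cons.
have val_w k : fib_value (w k) + c = fib (k.*2 + (size y).+2).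
  elim: k => // k IH; have := fibSS (k.*2 + (size y).+2).
  rewrite (_ : w k.+1 = [:: true, false & w k]) // !fib_value_cons [size (_ :: _)]/= size_w.
  by rewrite mul0n mul1n doubleS !addSn !addnS in IH *; lia.
split=> [[k [k_gt0 /fib_repP/and3P[_ _ /eqP <-]]] | [k k_gt0 En]].
  by exists k; last exact: val_w.
exists k; split=> //; apply/fib_repP; rewrite /canonical_fib_rep -/(w k) no11_w.
by rewrite -(eqn_add2r c) val_w En eqxx; case: k k_gt0 {En}.
Qed.

Theorem theorem3 :
  (forall i : nat,
     zero_run cubes_f 8 i <->
     in_plus_cat [:: true; false] [:: false; false; false; true] (fib_rep i)) /\
  (forall i : nat,
     zero_run cubes_f 7 i <->
     in_plus_cat [:: true; false] [:: false; true; false; false; true] (fib_rep i)).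
Proof.
split=> i.
  (* The deficit is 7 for both suffixes: 0001 has value 1 = F_6 - 7 and 01001 has value 6 = F_7 -
     7. *)
  rewrite long_zero_runP // (@in_plus_10_fib_rep _ 7) //;
    last by rewrite !fib_value_cons /fib_value big_ord0.
  split=> [[k [le8k Ei even_k]] | [k k_gt0 Ei]].
    exists (k - 6)./2; first by lia.
    by rewrite Ei; congr fib; rewrite /=; lia.
  by exists (k.*2 + 6); split=> //; lia.
rewrite long_zero_runP // (@in_plus_10_fib_rep _ 7) //;
    last by rewrite !fib_value_cons /fib_value big_ord0.
split=> [[k [le8k Ei odd_k]] | [k k_gt0 Ei]].
  exists (k - 7)./2; first by lia.
  by rewrite Ei; congr fib; rewrite /=; lia.
by exists (k.*2 + 7); split=> //; lia.
Qed.
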